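(* Let $G$ be an abelian squareful group of infinite order. Then $G$ has a directed $R_\infty$-terrace (for any index set $I$ with $|I|=|G|$).
   Context: An infinite group $G$ is squareful if $|\{g^2:g\in G\}|=|G|$. Let $\mathbb{F}$ be an ordered field and $I\subseteq\mathbb{F}$; for $d\in\mathbb{F}^+$ put $I_{(d)}=\{i\in I:i+d\in I\}$. $I$ is an index set if $|I|=|\mathbb{F}|$ and for every $d\in\mathbb{F}^+$ either $|I_{(d)}|=|\mathbb{F}|$ or $I_{(d)}=\emptyset$. A bijection $\mathbf a:I\to G\setminus\{e\}$ is a directed $R_\infty$-terrace for $G$ if for every $d\in\mathbb{F}^+$ with $I_{(d)}\ne\emptyset$ the map $\mathbf a_{(d)}:I_{(d)}\to G\setminus\{e\}$, $\mathbf a_{(d)}(i)=\mathbf a(i)^{-1}\mathbf a(i+d)$, is a bijection. *)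

(* Defs.v *)
From HB Require Import structures.
From mathcomp Require Import all_boot all_order all_algebra.
From mathcomp Require Import boolp classical_sets functions cardinality.

Set Implicit Arguments.
Unset Strict Implicit.
Unset Printing Implicit Defensive.

Import Order.TTheory GRing.Theory Num.Theory.

Local Open Scope classical_set_scope.
Local Open Scope card_scope.
Local Open Scope ring_scope.

(* Meaningful for infinite G only; infinity is assumed separately. *)
Definition squareful (G : groupType) : Prop :=
  [set (g ^+ 2)%g | g in [set: G]] #= [set: G].

(* [realFieldType] is the class of (totally) ordered fields; the norm it
   carries is the usual absolute value, determined by the order. *)
Definition shift_dom (F : realFieldType) (I : set F) (d : F) : set F :=
  [set i | I i /\ I (i + d)].

Definition index_set (F : realFieldType) (I : set F) : Prop :=
  I #= [set: F] /\
  forall d : F, 0 < d ->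
    shift_dom I d #= [set: F] \/ shift_dom I d = set0.

(* A map I -> G \ {e} is represented by a total function F -> G together with
   [set_bij I [set~ 1]]; its values outside I play no role. *)
Definition shift_quot (F : realFieldType) (G : groupType) (a : F -> G)
    (d : F) : F -> G :=
  fun i => ((a i)^-1 * a (i + d)%R)%g.

Definition directed_terrace (F : realFieldType) (G : groupType) (I : set F)
    (a : F -> G) : Prop :=
  set_bij I [set~ 1%g] a /\
  forall d : F, 0 < d -> shift_dom I d !=set0 ->
    set_bij (shift_dom I d) [set~ 1%g] (shift_quot a d).

Definition has_directed_terrace (G : groupType) : Prop :=
  exists (F : realFieldType) (I : set F),
    index_set I /\ exists a : F -> G, directed_terrace I a.

(* Main.v *)
Require Import Defs.
From HB Require Import structures.
From mathcomp Require Import all_boot all_order all_algebra.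
From mathcomp Require Import boolp classical_sets functions cardinality.
From mathcomp Require Import generic_quotient lra wochoice filter.

Set Implicit Arguments.
Unset Strict Implicit.
Unset Printing Implicit Defensive.

Import Order.TTheory GRing.Theory Num.Theory.

Local Open Scope classical_set_scope.
Local Open Scope card_scope.

(* Write G additively and let kappa = |G|. The graph of a directed terrace is a
   subset P of I x (G \ 0) which is total on I, onto G \ 0, injective in both
   coordinates, a Sidon set of the group F x G (p + q = r + s only if {p, q} =
   {r, s}), and whose differences exhaust all (d, g) with d > 0, I_(d) nonempty
   and g <> 0. Such a P is built by transfinite recursion of length kappa, one
   requirement per stage, from Sidon sets with fewer than kappa points: each
   stage adds one point (i, g), or two points (i, h), (i + d, h + g), and each
   possible coincidence rules out one value of the free coordinate, or one
   value of 2g when i is prescribed. Squarefulness handles the latter.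

   An ordered field of cardinality kappa is obtained as a subfield of an
   ultrapower of the rationals: for a fine ultrafilter on the finite sequences
   of elements of G, the kappa functions "position of x in s" are pairwise
   distinct almost everywhere. *)

(** * Cardinal arithmetic *)

Lemma card_le_inj T U (A : set T) (B : set U) (f : T -> U) :
  (forall x, A x -> B (f x)) ->
  (forall x y, A x -> A y -> f x = f y -> x = y) -> A #<= B.
Proof.
move=> fAB finj; apply: (@card_le_trans _ _ _ (f @` A)).
  have : f @` A #= A by apply: inj_card_eq => x y /set_mem ? /set_mem; exact: finj.
  by rewrite card_eq_le => /andP[].
by apply: subset_card_le => _ [x Ax <-]; exact: fAB.
Qed.

Lemma card_le_fun T U (u0 : U) (A : set T) (B : set U) : A #<= B ->
  exists f : T -> U, (forall x, A x -> B (f x)) /\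
    (forall x y, A x -> A y -> f x = f y -> x = y).
Proof.
elim/Ppointed: U => U in u0 B *; first by case: (no u0).
move=> /pcard_leP[f]; exists f; split => [x Ax|x y Ax Ay].
  exact: funS.
by apply: inj; rewrite inE.
Qed.

(** A choice of values turns [R] into a function, and the second hypothesis makes that function
    injective. This suits the graphs produced by Zorn's lemma and their transposes. *)
Lemma card_le_rel T U (A : set T) (B : set U) (R : set (T * U)) :
  (forall x, A x -> exists2 y, B y & R (x, y)) ->
  (forall x x' y, R (x, y) -> R (x', y) -> x = x') -> A #<= B.
Proof.
move=> Rtot Rinj; case: (pselect (exists u : U, True)) => [[u0 _]|U0]; last first.
  have -> : A = set0; last exact: card_ge0.
  by rewrite -subset0 => x /Rtot[y _ _]; case: U0; exists y.
have /choice[f fP] : forall x, exists y, A x -> B y /\ R (x, y).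
  move=> x; case: (pselect (A x)) => [/Rtot[y By Rxy]|nAx]; first by exists y.
  by exists u0.
apply: (@card_le_inj _ _ _ _ f) => [x /fP[]//|x y /fP[_ Rx] /fP[_ Ry] fxy].
by apply: Rinj Rx _; rewrite fxy.
Qed.

(* Zorn's lemma on the graphs of partial injections from A to B. *)
Lemma card_le_total T U (A : set T) (B : set U) : A #<= B \/ B #<= A.
Proof.
pose P (R : set (T * U)) := [/\ forall x y, R (x, y) -> A x /\ B y,
  forall x y y', R (x, y) -> R (x, y') -> y = y' &
  forall x x' y, R (x, y) -> R (x', y) -> x = x'].
have [|R [[RAB Rfun Rinj] Rmax]] := @Zorn_bigcup _ P.
  move=> F FP Ftot.
  have sub2 p q X Y : F X -> F Y -> X p -> Y q ->
      exists Z, [/\ F Z, Z p & Z q].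
    move=> FX FY Xp Yq; case: (Ftot _ _ FX FY) => [XY|YX].
      by exists Y; split => //; apply: XY.
    by exists X; split => //; apply: YX.
  split=> [x y [X FX Xxy]|x y y' [X FX Xp] [Y FY Yp]|x x' y [X FX Xp] [Y FY Yp]].
  - by have [+ _ _] := FP _ FX; apply.
  - have [Z [FZ Zp Zq]] := sub2 _ _ _ _ FX FY Xp Yp.
    by have [_ + _] := FP _ FZ; apply; eassumption.
  - have [Z [FZ Zp Zq]] := sub2 _ _ _ _ FX FY Xp Yp.
    by have [_ _ +] := FP _ FZ; apply; eassumption.
case: (pselect (forall x, A x -> exists y, R (x, y))) => [tot|].
  left; apply: (@card_le_rel _ _ _ _ R) => // x /tot[y Rxy].
  by exists y => //; have [] := RAB _ _ Rxy.
move=> /existsNP[x0 /not_implyP[Ax0 /forallNP x0R]].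
right; apply: (@card_le_rel _ _ _ _ [set p | R (p.2, p.1)]) => /=; last first.
  by move=> y y' x; exact: Rfun.
move=> y By; apply: contrapT => yR.
have {}yR x : ~ R (x, y).
  by move=> Rxy; apply: yR; exists x => //; have [] := RAB _ _ Rxy.
have /Rmax : R `<` R `|` [set (x0, y)].
  split=> [p Rp|]; first by left.
  by move=> /(_ (x0, y)) RR; apply: (x0R y); apply: RR; right.
apply; split => [x z [/RAB//|[-> ->]//]| |].
- move=> x z z' [Rxz|[xE ->]] [Rxz'|[xE' ->]] //; first exact: Rfun Rxz Rxz'.
    by move: Rxz; rewrite xE' => /x0R.
  by move: Rxz'; rewrite xE => /x0R.
- move=> x x' z [Rxz|[-> zE]] [Rxz'|[-> zE']] //; first exact: Rinj Rxz Rxz'.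
    by move: Rxz; rewrite zE' => /yR.
  by move: Rxz'; rewrite zE => /yR.
Qed.

Lemma card_le_neq0 T U (A : set T) (B : set U) :
  A !=set0 -> A #<= B -> B !=set0.
Proof.
move=> A0 AB; apply/set0P/eqP => B0; move: AB A0; rewrite B0.
by move=> /card_le0P -> [].
Qed.

Lemma card_leX T T' U U' (A : set T) (A' : set T') (B : set U) (B' : set U') :
  A #<= A' -> B #<= B' -> A `*` B #<= A' `*` B'.
Proof.
move=> AA BB; case: (pselect (exists p, (A `*` B) p)) => [[[x y] [/= Ax By]]|n].
  have [t0 _] := card_le_neq0 (ex_intro _ _ Ax) AA.
  have [u0 _] := card_le_neq0 (ex_intro _ _ By) BB.
  have [f [fA finj]] := card_le_fun t0 AA; have [g [gB ginj]] := card_le_fun u0 BB.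
  apply: (@card_le_inj _ _ _ _ (fun p => (f p.1, g p.2))).
    by move=> [? ?] [/= /fA ? /gB ?].
  move=> [? ?] [? ?] [/= ? ?] [/= ? ?] [fx gy].
  by congr pair; [exact: finj|exact: ginj].
have -> : A `*` B = set0 by rewrite -subset0 => p ABp; apply: n; exists p.
exact: card_ge0.
Qed.

Lemma infinite_pair T (A : set T) : infinite_set A ->
  exists x y, [/\ A x, A y & x <> y].
Proof.
move=> Ainf; have [x Ax] := infinite_setN0 Ainf.
have [y [Ay /= yx]] : (A `\ x) !=set0.
  by apply: infinite_setN0; apply: infinite_setD => //; exact: finite_set1.
by exists x, y; split => // xy; apply: yx.
Qed.

(** Two distinct elements [u] and [v] of [S] serve as tags: [A] goes into {u} x S and the rest of
    [B] into {v} x S. *)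
Lemma card_le_double T U (A B : set T) (S : set U) : infinite_set S ->
  S `*` S #<= S -> A #<= S -> B #<= S -> A `|` B #<= S.
Proof.
move=> Sinf SS AS BS; have [u [v [Su Sv uv]]] := infinite_pair Sinf.
apply: card_le_trans SS.
have [f [fA finj]] := card_le_fun u AS; have [g [gB ginj]] := card_le_fun u BS.
apply: (@card_le_inj _ _ _ _ (fun x => if x \in A then (u, f x) else (v, g x))).
  move=> x; case: ifPn => [/set_mem Ax _|/negP xA [/mem_set//|Bx]].
    by split => //=; exact: fA.
  by split => //=; exact: gB.
move=> x y; case: ifPn => [/set_mem Ax _|/negP xA [/mem_set//|Bx]];
  case: ifPn => [/set_mem Ay _|/negP yA [/mem_set//|By]] [] //.
- exact: finj.
- by move=> /esym.
- exact: ginj.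
Qed.

(* Zorn's lemma on the graphs of injections S * S -> S with S an infinite
   subset of A; S is recovered as the diagonal of the domain of the graph. *)
Lemma infinite_card_sq T (A : set T) : infinite_set A -> A `*` A #<= A.
Proof.
move=> Ainf.
pose S (R : set (T * T * T)) x := exists z, R (x, x, z).
pose P (R : set (T * T * T)) :=
  [/\ (forall x y z, R (x, y, z) ->
         [/\ S R x, S R y & S R z] /\ [/\ A x, A y & A z]),
    (forall x y, S R x -> S R y -> exists z, R (x, y, z)),
    (forall p q z, R (p, z) -> R (q, z) -> p = q) &
    (* The guard lets the union of the empty chain satisfy [P]. *)
    (R !=set0 -> infinite_set [set x | S R x])].
have SS X Y x : X `<=` Y -> S X x -> S Y x by move=> XY [z /XY]; exists z.
have [|R [[RS Rtot Rinj Rinf] Rmax]] := @Zorn_bigcup _ P.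
  move=> F FP Ftot.
  have sub X : F X -> X `<=` \bigcup_(Y in F) Y by move=> FX p Xp; exists X.
  have sub2 p q X Y : F X -> F Y -> X p -> Y q ->
      exists Z, [/\ F Z, Z p & Z q].
    move=> FX FY Xp Yq; case: (Ftot _ _ FX FY) => [XY|YX].
      by exists Y; split => //; apply: XY.
    by exists X; split => //; apply: YX.
  split.
  - move=> x y z [X FX Xp]; have [+ _ _ _] := FP _ FX.
    by move=> /(_ _ _ _ Xp)[[? ? ?] ?]; split => //; split; apply: SS (sub _ FX) _.
  - move=> x y [zx [X FX Xx]] [zy [Y FY Yy]].
    have [Z [FZ Zx Zy]] := sub2 _ _ _ _ FX FY Xx Yy.
    have [_ /(_ x y) + _ _] := FP _ FZ.
    case=> [||z Zz]; [by exists zx|by exists zy|].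
    by exists z; exists Z.
  - move=> p q z [X FX Xp] [Y FY Yq].
    have [Z [FZ Zp Zq]] := sub2 _ _ _ _ FX FY Xp Yq.
    by have [_ _ + _] := FP _ FZ; apply; eassumption.
  - move=> [p [X FX Xp]]; have [_ _ _ Xinf] := FP _ FX.
    apply: sub_infinite_set (Xinf _); last by exists p.
    by move=> x; apply: SS; exact: sub.
have SA x : S R x -> A x by move=> [z /RS[_ []]].
have Sinf : infinite_set [set x | S R x].
  (* Were [R] empty, a countable subset of [A] with a pairing function on [nat] would give a larger
     graph. *)
  apply: Rinf; apply: contrapT => R0.
  have [a0 _] := infinite_setN0 Ainf.
  have /infiniteP/(card_le_fun a0)[f [fA finj]] := Ainf.
  have finj' m n : f m = f n -> m = n by exact: finj.
  have [g [_ ginj]] : exists g : nat * nat -> nat, (forall p, setT p -> setT (g p))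
      /\ forall p q, setT p -> setT q -> g p = g q -> p = q.
    by apply: (card_le_fun 0%N); have := card_nat2; rewrite card_eq_le => /andP[].
  pose R0' : set (T * T * T) :=
    [set p | exists m n, p = (f m, f n, f (g (m, n)))].
  have R0S x : S R0' x <-> exists n, x = f n.
    split=> [[z [m [n [-> _ _]]]]|[n ->]]; first by exists m.
    by exists (f (g (n, n))); exists n, n.
  have /Rmax : R `<` R0'.
    split=> [p Rp|]; first by case: R0; exists p.
    move=> /(_ (f 0%N, f 0%N, f (g (0%N, 0%N)))) RR.
    by apply: R0; eexists; apply: RR; exists 0%N, 0%N.
  apply; split.
  - move=> x y z [m [n [-> -> ->]]]; split; last by split; exact: fA.
    by split; apply/R0S; eexists.
  - move=> x y /R0S[m ->] /R0S[n ->].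
    by exists (f (g (m, n))); exists m, n.
  - move=> p q z [m [n [-> ->]]] [m' [n' [-> /finj' gE]]].
    by have [-> ->] := ginj _ _ I I gE.
  - move=> _; apply/infiniteP; apply: (@card_le_inj _ _ _ _ f) => [n _|]; last by [].
    by apply/R0S; exists n.
have SSS : [set x | S R x] `*` [set x | S R x] #<= [set x | S R x].
  apply: (@card_le_rel _ _ _ _ R) => [[x y] [/= Sx Sy]|]; last exact: Rinj.
  have [z Rz] := Rtot _ _ Sx Sy; exists z => //.
  by have [[_ _]] := RS _ _ _ Rz.
have SleA : [set x | S R x] #<= A by apply: subset_card_le => x; exact: SA.
(* Either [A] is no larger than S, and [R] gives the conclusion, or the complement of S in [A]
   contains a copy g(S) of S, and [R] extends to S' = S + g(S), against maximality. *)
have [AS|/(card_le_trans _) SAS] := card_le_total (A `\` [set x | S R x]) [set x | S R x].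
  have AleS : A #<= [set x | S R x].
    have -> : A = (A `\` [set x | S R x]) `|` [set x | S R x].
      by rewrite setUC setDUK // => x; exact: SA.
    exact: card_le_double.
  apply: card_le_trans SleA; apply: card_le_trans SSS.
  exact: card_leX.
exfalso.
have [s0 Ss0] := infinite_setN0 Sinf.
have [g [gS ginj]] := card_le_fun s0 (SAS _ _ (card_lexx _)).
pose S' := [set x | S R x] `|` g @` [set x | S R x].
have S'S : S' #<= [set x | S R x].
  by apply: card_le_double => //; exact: card_image_le.
have /(card_le_fun s0)[k [kS kinj]] : S' `*` S' #<= [set x | S R x].
  by apply: card_le_trans SSS; exact: card_leX.
(* The new pairs get values outside S, hence distinct from all values of [R]. *)
pose R' := R `|` [set p | [/\ S' p.1.1, S' p.1.2,
   ~ (S R p.1.1 /\ S R p.1.2) & p.2 = g (k p.1)]].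
have SS' x : S R x -> S' x by move=> ?; left.
have S'A x : S' x -> A x by move=> [/SA//|[y /gS[? _] <-]].
have gS' p : S' p.1 -> S' p.2 -> S' (g (k p)).
  by move=> p1 p2; right; exists (k p) => //; apply: kS.
have gk p z : S' p.1 -> S' p.2 -> R z -> z.2 = g (k p) -> False.
  move=> p1 p2 Rz zE; have [_] : (A `\` [set x | S R x]) (g (k p)) by apply/gS/kS.
  by apply; rewrite /= -zE; case: z Rz {zE} => [[x y] z] /RS[[]].
have SR' x : S R' x <-> S' x.
  split=> [[z [Rz|[/= ? ?]//]]|S'x]; first by left; exists z.
  case: (pselect (S R x)) => [[z Rz]|nS]; first by exists z; left.
  by exists (g (k (x, x))); right; split => //= -[].
have /Rmax : R `<` R'.
  split=> [p Rp|R'R]; first by left.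
  have [_ nS] := gS _ Ss0.
  have : S R (g s0) by apply: SS R'R _; apply/SR'; right; exists s0.
  exact: nS.
apply; split.
- move=> x y z [/RS[[Sx Sy Sz] ?]|[/= S'x S'y _ zE]].
    by split => //; split; apply/SR'/SS'.
  have S'z : S' z by rewrite zE; apply: gS'.
  by split; split; (exact: S'A || apply/SR').
- move=> x y /SR' S'x /SR' S'y.
  case: (pselect (S R x /\ S R y)) => [[Sx Sy]|nS].
    by have [z Rz] := Rtot _ _ Sx Sy; exists z; left.
  by exists (g (k (x, y))); right.
- move=> p q z [Rp|[p1 p2 _ zp]] [Rq|[q1 q2 _ zq]].
  + exact: Rinj Rp Rq.
  + by case: (gk _ _ q1 q2 Rp).
  + by case: (gk _ _ p1 p2 Rq).
  + apply: kinj => //; apply: ginj; [exact: kS|exact: kS|].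
    by rewrite -zp -zq.
- move=> _; apply: sub_infinite_set Sinf => x Sx; apply/SR'; exact: SS'.
Qed.

(* By card_le_total this says |A| < |K|. *)
Definition small (K T : Type) (A : set T) : Prop := ~ ([set: K] #<= A).

(** * Small sets and transfinite recursion *)

Section Small.
Variables (K : Type) (Kinf : infinite_set [set: K]).

Lemma small_le T U (A : set T) (B : set U) : A #<= B -> small K B -> small K A.
Proof. by move=> AB KB KA; apply: KB; exact: card_le_trans AB. Qed.

Lemma small_subset T (A B : set T) : A `<=` B -> small K B -> small K A.
Proof. by move/subset_card_le; exact: small_le. Qed.

Lemma small_image T U (f : T -> U) (A : set T) : small K A -> small K (f @` A).
Proof. exact/small_le/card_image_le. Qed.

Lemma finite_small T (A : set T) : finite_set A -> small K A.
Proof. by move=> Afin KA; apply/Kinf/(card_le_finite KA). Qed.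

(** If the product is infinite, so is the larger factor, and the product embeds into the square of
    that factor, hence into the factor itself. *)
Lemma small_setX T U (A : set T) (B : set U) :
  small K A -> small K B -> small K (A `*` B).
Proof.
move=> sA sB; case: (pselect (finite_set (A `*` B))) => [|ABinf].
  exact: finite_small.
have [AB|BA] := card_le_total A B.
  have Binf : infinite_set B.
    by move=> Bfin; apply: ABinf; apply: finite_setX => //; exact: card_le_finite AB Bfin.
  apply: small_le sB; apply: card_le_trans (infinite_card_sq Binf).
  exact: card_leX.
have Ainf : infinite_set A.
  by move=> Afin; apply: ABinf; apply: finite_setX => //; exact: card_le_finite BA Afin.
apply: small_le sA; apply: card_le_trans (infinite_card_sq Ainf).
exact: card_leX.
Qed.

Lemma small_setU T (A B : set T) : small K A -> small K B -> small K (A `|` B).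
Proof.
move=> sA sB; have [->|/set0P[x0 Ax0]] := eqVneq A set0; first by rewrite set0U.
have [->|/set0P[y0 By0]] := eqVneq B set0; first by rewrite setU0.
have sAB : small K ((A `*` B) `*` [set: bool]).
  by apply: small_setX; [exact: small_setX|exact: finite_small].
apply: (@small_subset _ _ ((fun p => if p.2 then p.1.1 else p.1.2) @`
  ((A `*` B) `*` [set: bool]))); last exact: small_image.
move=> x [Ax|Bx]; first by exists ((x, y0), true).
by exists ((x0, x), false).
Qed.

Lemma avoid_small T (A B : set T) : [set: K] #<= A -> small K B ->
  exists2 x, A x & ~ B x.
Proof.
move=> KA sB; apply: contrapT => nex; apply: sB; apply: card_le_trans KA _.
apply: subset_card_le => x Ax; apply: contrapT => nBx; apply: nex.
by exists x.
Qed.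

(** Well-order [K]. If some proper initial segment is as large as [K], take the least [x] bounding
    such a segment and pull the order back along an injection of [K] below [x]; minimality of [x]
    makes the segments small. *)
Lemma initial_well_order : exists lt : K -> K -> Prop,
  [/\ well_founded lt, forall x y z, lt x y -> lt y z -> lt x z,
    forall x y, [\/ lt x y, x = y | lt y x] &
    forall x, small K [set y | lt y x]].
Proof.
have [R Rwo] := well_ordering_principle {classic K}.
have Rle : forall (A : set K) x0, A x0 -> exists2 x, A x & forall y, A y -> R x y.
  move=> A x0 Ax0; have [|x [[xA xmin] _]] := Rwo [pred x | x \in A].
    by exists x0; apply/mem_set.
  by exists x => [|y Ay]; [exact: set_mem|apply: xmin; exact: mem_set].
have Rtot x y : R x y \/ R y x.
  have [z [->|->] zmin] := Rle [set x; y] x (or_introl erefl).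
    by left; apply: zmin; right.
  by right; apply: zmin; left.
have Rxx x : R x x by case: (Rtot x x).
have Ranti x y : R x y -> R y x -> x = y.
  move=> Rxy Ryx; have [|z [_ zU]] := Rwo [pred z | (z == x) || (z == y)].
    by exists x; rewrite inE eqxx.
  rewrite -(zU x) ?(zU y) //; split; rewrite ?inE ?eqxx ?orbT // => w;
    by rewrite inE => /orP[]/eqP->.
have Rtrans x y z : R x y -> R y z -> R x z.
  move=> Rxy Ryz.
  have [w [[->|->]|->] wmin] :=
    Rle [set x; y; z] x (or_introl (or_introl erefl)).
  - by apply: wmin; right.
  - have Ryx : R y x by apply: wmin; left; left.
    by rewrite (Ranti _ _ Rxy Ryx).
  - have Rzx : R z x by apply: wmin; left; left.
    have Rzy : R z y by apply: wmin; left; right.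
    by rewrite (Ranti _ _ Ryz Rzy) in Rxy *.
have [f [finj fsmall]] : exists f : K -> K, injective f /\
    forall x, small K [set y | R y (f x) /\ y <> f x].
  case: (pselect (exists x, ~ small K [set y | R y x /\ y <> x])) => [[x0]|nex].
    move=> /(Rle [set x | ~ small K [set y | R y x /\ y <> x]])[x /contrapT Kx xmin].
    have [f [fK finj]] := card_le_fun x0 Kx.
    exists f; split=> [y z /finj|y]; first exact.
    have [Rfx fxN] := fK y I.
    by apply: contrapT => /xmin /(Ranti _ _ Rfx).
  by exists id; split => // x; apply: contrapT => ?; apply: nex; exists x.
exists (fun x y => R (f x) (f y) /\ f x <> f y); split.
- move=> x; apply: contrapT => nAx.
  have [|y [z nAz <-] zmin] :=
    Rle [set f z | z in [set z | ~ Acc (fun x y => R (f x) (f y) /\ f x <> f y) z]] (f x).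
    by exists x.
  apply: nAz; constructor => w [Rwz wz]; apply: contrapT => nAw.
  by apply/wz/Ranti => //; apply: zmin; exists w.
- move=> x y z [Rxy xy] [Ryz yz]; split; first exact: Rtrans Ryz.
  by move=> xz; rewrite xz in Rxy xy; apply: xy; exact: Ranti.
- move=> x y; case: (pselect (x = y)) => [->|xy]; first exact: Or32.
  have fxy : f x <> f y by move/finj.
  by case: (Rtot (f x) (f y)) => ?; [apply: Or31|apply: Or33; split => // /esym].
- move=> x; apply: small_le (fsmall x); apply: (@card_le_inj _ _ _ _ f) => //.
  by move=> ? ? _ _; exact: finj.
Qed.

(* Transfinite recursion along a well-order of K with small initial segments:
   at stage t two points are added so as to meet the requirement [req t]. *)
Lemma small_recursion (X : choiceType) (x0 : X)
  (ok : X -> X -> X -> X -> Prop) (req : K -> set X -> Prop)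
  (good := fun P : set X => forall p q r s, P p -> P q -> P r -> P s -> ok p q r s) :
  (forall t (P Q : set X), P `<=` Q -> req t P -> req t Q) ->
  (forall t (P : set X), small K P -> good P ->
     exists x y, good (P `|` [set x; y]) /\ req t (P `|` [set x; y])) ->
  exists P, good P /\ forall t, req t P.
Proof.
move=> req_mono ext.
have [lt [lt_wf lt_trans lt_tot lt_small]] := initial_well_order.
pose below (D : K -> X * X) t := [set x | exists2 s, lt s t & x = (D s).1 \/ x = (D s).2].
(* The default of [xget] is never returned: [stageP] shows by induction that a suitable pair exists
   at every stage. *)
pose step t (P : set X) : X * X := xget (x0, x0)
  [set d | good (P `|` [set d.1; d.2]) /\ req t (P `|` [set d.1; d.2])].
pose below' t (D : forall s, lt s t -> X * X) :=
  [set x | exists s (st : lt s t), x = (D s st).1 \/ x = (D s st).2].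
pose D := Fix lt_wf (fun _ => (X * X)%type) (fun t D => step t (below' t D)).
have DE t : D t = step t (below D t).
  rewrite /D Fix_eq; last first.
    move=> x f g fg; congr (step _ _); congr below'.
    by apply: functional_extensionality_dep => s; apply: functional_extensionality_dep.
  congr (step _ _); rewrite eqEsubset; split => x.
    by move=> [s [st xE]]; exists s.
  by move=> [s st xE]; exists s, st.
pose upto t := below D t `|` [set (D t).1; (D t).2].
have uptoP x t : upto t x <-> exists2 s, lt s t \/ s = t & x = (D s).1 \/ x = (D s).2.
  split=> [[[s st xE]|xE]|[s [st|->] xE]];
    [by exists s; [left|]|by exists t; [right|]|..].
    by left; exists s.
  by right.
have upto_le s t : lt s t \/ s = t -> upto s `<=` upto t.
  move=> [st|->//] x /uptoP[r rs xE]; apply/uptoP; exists r => //.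
  by left; case: rs => [/lt_trans|->//]; apply.
(* The stages form a chain, so any four points of a union of stages lie in a single one. This is
   used below each [t] and for the final union. *)
have good_dir (I : set K) (P : set X) : (forall x, P x -> exists2 t, I t & upto t x) ->
    (forall t, I t -> good (upto t)) -> good P.
  move=> Pup Igood p q r s.
  move=> /Pup[tp Itp pt] /Pup[tq Itq qt] /Pup[tr Itr rt] /Pup[ts Its st].
  have maxI t t' : I t -> I t' -> exists2 u, I u &
      (upto t `<=` upto u) /\ (upto t' `<=` upto u).
    move=> It It'; case: (lt_tot t t') => tt'.
    - by exists t' => //; split => //; apply: upto_le; left.
    - by exists t => //; rewrite tt'; split.
    - by exists t => //; split => //; apply: upto_le; left.
  have [u Iu [pu qu]] := maxI _ _ Itp Itq.
  have [v Iv [rv sv]] := maxI _ _ Itr Its.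
  have [w Iw [uw vw]] := maxI _ _ Iu Iv.
  apply: (Igood w Iw); [exact/uw/pu|exact/uw/qu|exact/vw/rv|exact/vw/sv].
have stageP t : good (upto t) /\ req t (upto t).
  elim/(well_founded_ind lt_wf): t => t IH.
  suff : [set d | good (below D t `|` [set d.1; d.2]) /\
       req t (below D t `|` [set d.1; d.2])] (D t) by [].
  rewrite DE; apply: xgetPex.
  have [||x [y xy]] := ext t (below D t); last by exists (x, y).
    apply: (@small_subset _ _ ((fun p => if p.2 then (D p.1).1 else (D p.1).2) @`
        ([set s | lt s t] `*` [set: bool]))).
      by move=> x [s st [->|->]]; [exists (s, true)|exists (s, false)].
    by apply: small_image; apply: small_setX => //; exact: finite_small.
  apply: (good_dir [set s | lt s t]) => [x [s st xE]|s /IH[]//].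
  by exists s => //; right.
exists (\bigcup_(t in [set: K]) upto t); split.
  by apply: (good_dir setT) => [x [t _ xt]|t _]; [exists t|have [] := stageP t].
move=> t; have [_] := stageP t; apply: req_mono => x xt.
by exists t.
Qed.

End Small.

(** * Extending Sidon sets *)

Section Sidon.
Local Open Scope ring_scope.
Variables (F : realFieldType) (V : zmodType) (I : set F).
Hypothesis Vinf : infinite_set [set: V].
Hypothesis Vsq : [set: V] #<= [set v + v | v in [set: V]].
Local Notation X := (F * V)%type.

(** Each clause involves at most four points, which gives [sidon] the form of [good] in
    [small_recursion]. *)
Definition sidon_ok (p q r s : X) : Prop :=
  [/\ I p.1, p.2 <> 0, p.1 = q.1 -> p = q, p.2 = q.2 -> p = q &
      p + q = r + s -> p = r \/ p = s].

Definition sidon (P : set X) : Prop :=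
  forall p q r s, P p -> P q -> P r -> P s -> sidon_ok p q r s.

(** A coincidence with [p] on both sides cancels to a trivial one, so only those with [p] on one
    side, once or twice, have to be excluded. *)
Lemma sidon_add P p : sidon P -> I p.1 -> p.2 <> 0 ->
  (forall q, P q -> p.1 <> q.1) -> (forall q, P q -> p.2 <> q.2) ->
  (forall q r s, P q -> P r -> P s -> p + q <> r + s) ->
  (forall r s, P r -> P s -> p + p <> r + s) ->
  sidon (P `|` [set p]).
Proof.
move=> Pok Ip p0 p1 p2 p3 p4 a b c d Pa Pb Pc Pd.
have fst_inj x y : (P `|` [set p]) x -> (P `|` [set p]) y -> x.1 = y.1 -> x = y.
  move=> [Px|->] [Py|->] //.
  - by have [_ _ + _ _] := Pok x y x y Px Py Px Py; apply.
  - by move=> /esym /p1 - /(_ Px).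
  - by move=> /p1 - /(_ Py).
split.
- by case: Pa => [Pa|->//]; have [] := Pok a a a a Pa Pa Pa Pa.
- by case: Pa => [Pa|->//]; have [] := Pok a a a a Pa Pa Pa Pa.
- exact: fst_inj.
- case: Pa Pb => [Pa|->] [Pb|->] //.
  + by have [_ _ _ + _] := Pok a b a b Pa Pb Pa Pb; apply.
  + by move=> /esym /p2 - /(_ Pa).
  + by move=> /p2 - /(_ Pb).
- move=> abcd; have [->|ac] := eqVneq a c; first by left.
  have [->|ad] := eqVneq a d; first by right.
  exfalso; have bd : b <> d.
    by move=> bd; move: abcd; rewrite bd => /addIr /eqP; rewrite (negbTE ac).
  have bc : b <> c.
    by move=> bc; move: abcd; rewrite bc addrC => /addrI /eqP; rewrite (negbTE ad).
  move: abcd ac ad bc bd.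
  case: Pa => [Pa|->]; case: Pb => [Pb|->]; case: Pc => [Pc|->]; case: Pd => [Pd|->];
    rewrite ?eqxx // => abcd ac ad bc bd.
  + have [_ _ _ _ /(_ abcd)[]/eqP] := Pok a b c d Pa Pb Pc Pd.
      exact/negP.
    exact/negP.
  + by apply: (p3 c a b) => //; rewrite abcd addrC.
  + by apply: (p3 d a b).
  + by apply: (p4 a b).
  + by apply: (p3 a c d) => //; rewrite addrC.
  + by apply: (p3 b c d).
  + by apply: (p4 c d).
Qed.

(* The values to be avoided when a point is added to P are of the form
   f q r s with q, r, s in P or zero. *)
Definition forms Y (fs : seq (X -> X -> X -> Y)) (P : set X) : set Y :=
  [set y | exists k q r s, [/\ (k < size fs)%N, (P `|` [set 0]) q,
     (P `|` [set 0]) r, (P `|` [set 0]) s & y = nth (fun _ _ _ => y) fs k q r s]].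

Lemma small_forms Y (fs : seq (X -> X -> X -> Y)) P :
  small V P -> small V (forms fs P).
Proof.
move=> sP; have sP0 : small V (P `|` [set 0]).
  by apply: small_setU => //; apply: finite_small => //; exact: finite_set1.
(* The head of the list is the default of [nth] below; the empty list is treated apart, as it yields
   no values. *)
case: fs => [|f0 fs].
  by move=> Vle; have [y [k [? [? [? []]]]]] := card_le_neq0 (infinite_setN0 Vinf) Vle.
pose P3 := ((P `|` [set 0]) `*` (P `|` [set 0])) `*` (P `|` [set 0]).
apply: (@small_subset _ _ _ ((fun p : (X * X * X) * nat =>
    nth f0 (f0 :: fs) p.2 p.1.1.1 p.1.1.2 p.1.2) @` (P3 `*` `I_(size fs).+1))).
  move=> y [k [q [r [s [ks Pq Pr Ps yE]]]]]; exists (q, r, s, k) => //=.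
  by rewrite yE; congr (_ _ _ _); apply: set_nth_default.
apply: small_image; do ![apply: small_setX => //].
by apply: finite_small => //; exact: finite_II.
Qed.

Lemma forms_neq Y (fs : seq (X -> X -> X -> Y)) P y : ~ forms fs P y ->
  forall k q r s, (k < size fs)%N -> (P `|` [set 0]) q ->
     (P `|` [set 0]) r -> (P `|` [set 0]) s ->
  y <> nth (fun _ _ _ => y) fs k q r s.
Proof. by move=> nf k q r s ks Pq Pr Ps yE; apply: nf; exists k, q, r, s. Qed.

(** By [Vsq] there are at least |V| doubles, while fewer than |V| elements are doubles from [B] or
    lie in [C]. *)
Lemma avoid_double (B C : set V) : small V B -> small V C ->
  exists2 v, ~ B v & ~ C (v + v).
Proof.
move=> sB sC; have sBC : small V ([set v + v | v in B] `|` C).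
  by apply: small_setU => //; exact: small_image.
have [w [v _ <-] nBC] := avoid_small Vsq sBC.
by exists v => ?; apply: nBC; [left; exists v|right].
Qed.

Lemma sidon_add_index P i : small V P -> sidon P -> I i ->
  exists v, sidon (P `|` [set (i, v)]).
Proof.
move=> sP Pok Ii; case: (pselect (exists v, P (i, v))) => [[v Pv]|nP].
  by exists v; rewrite (_ : P `|` _ = P) // setUidl // => _ ->.
(* With zeros in some slots the first form also yields v <> 0 and v <> s.2. The second form excludes
   values of 2v, for the coincidence p + p = r + s. *)
have [v nB nC] := avoid_double
  (@small_forms _ [:: fun q r s : X => r.2 + s.2 - q.2] _ sP)
  (@small_forms _ [:: fun q r s : X => r.2 + s.2] _ sP).
have vB := forms_neq nB; have vC := forms_neq nC.
have P0 : (P `|` [set 0]) 0 by right.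
exists v; apply: sidon_add => //= [v0|q Pq iq|q Pq vq|q r s Pq Pr Ps|r s Pr Ps].
- by apply: (vB 0%N 0 0 0) => //=; rewrite subr0 addr0.
- by apply: nP; exists q.2; rewrite iq; case: q Pq {iq}.
- by apply: (vB 0%N 0 0 q) => //=; [left|rewrite subr0 add0r].
- move=> [_ E]; apply: (vB 0%N q r s) => //=; [by left..|].
  by rewrite -E addrK.
- by move=> [_ E]; apply: (vC 0%N 0 r s) => //=; left.
Qed.

(** Here the first coordinate is free and 2 is invertible in [F], so p + p = r + s excludes a single
    [i]. *)
Lemma sidon_add_value P v : [set: V] #<= I -> small V P -> sidon P -> v <> 0 ->
  exists i, sidon (P `|` [set (i, v)]).
Proof.
move=> VI sP Pok v0; case: (pselect (exists i, P (i, v))) => [[i Pi]|nP].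
  by exists i; rewrite (_ : P `|` _ = P) // setUidl // => _ ->.
have [i Ii nB] := avoid_small VI
  (@small_forms _ [:: fun q r s : X => r.1 + s.1 - q.1;
     fun q r s => (r.1 + s.1) / 2] _ sP).
have iB := forms_neq nB.
have P0 : (P `|` [set 0]) 0 by right.
exists i; apply: sidon_add => //= [q Pq iq|q Pq vq|q r s Pq Pr Ps|r s Pr Ps].
- by apply: (iB 0%N 0 0 q) => //=; [left|rewrite subr0 add0r].
- by apply: nP; exists q.1; rewrite vq; case: q Pq {vq}.
- move=> [E _]; apply: (iB 0%N q r s) => //=; [by left..|].
  by rewrite -E addrK.
- move=> [E _]; apply: (iB 1%N 0 r s) => //=; [by left..|].
  by lra.
Qed.

(* The only coincidence that no choice of i can prevent is
   (i + d, h + v) + q = (i, h) + s, which says that (d, v) is already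
   a difference of two points of P. *)
Lemma sidon_add_difference P d v : 0 < d -> [set: V] #<= shift_dom I d ->
  small V P -> sidon P -> v <> 0 ->
  exists p q, sidon (P `|` [set p; q]) /\
    exists x y, [/\ (P `|` [set p; q]) x, (P `|` [set p; q]) y & y = x + (d, v)].
Proof.
move=> d0 VI sP Pok v0.
case: (pselect (exists x y, [/\ P x, P y & y = x + (d, v)])) => [[x [y [Px Py yE]]]|nP].
  exists x, y; rewrite (_ : P `|` _ = P); first by split => //; exists x, y.
  by apply: setUidl => z [->|->].
(* The first two forms serve for the point (i, h). The others exclude, in this order, i + d + q = r
   + s, 2i + d = r + s, i + d + q = 2i, 2(i + d) = r + s and 2(i + d) = i + q in the first
   coordinates. *)
have [i [Ii Iid] niB] := avoid_small VI (@small_forms _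
  [:: fun q r s : X => r.1 + s.1 - q.1; fun q r s => (r.1 + s.1) / 2;
      fun q r s => r.1 + s.1 - q.1 - d; fun q r s => (r.1 + s.1 - d) / 2;
      fun q r s => q.1 + d; fun q r s => (r.1 + s.1) / 2 - d;
      fun q r s => q.1 - d - d] _ sP).
have iB := forms_neq niB.
(* It remains to make [h] and [h + v] nonzero and distinct from the second coordinates of [P]; zero
   in the slot gives the former. *)
have [h _ nhB] := avoid_small (card_lexx [set: V]) (@small_forms _
  [:: fun q r s : X => q.2; fun q r s => q.2 - v] _ sP).
have hB := forms_neq nhB.
have eq_pair (x y : X) : x.1 = y.1 -> x.2 = y.2 -> x = y.
  by case: x y => [? ?] [? ?] /= -> ->.
have P0 : (P `|` [set 0]) 0 by right.
have sub q : P q -> (P `|` [set 0]) q by left.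
have P1ok : sidon (P `|` [set (i, h)]).
  apply: sidon_add => //= [h0|q Pq iq|q Pq hq|q r s Pq Pr Ps [E _]|r s Pr Ps [E _]].
  - by apply: (hB 0%N 0 0 0).
  - by apply: (iB 0%N 0 0 q) => //=; [left|rewrite subr0 add0r].
  - by apply: (hB 0%N q 0 0) => //=; left.
  - apply: (iB 0%N q r s) => //=; [by left..|].
    by rewrite -E addrK.
  - apply: (iB 1%N 0 r s) => //=; [by left..|].
    by lra.
exists (i, h), (i + d, h + v); split; last first.
  by exists (i, h), (i + d, h + v); split; [right; left|right; right|].
rewrite setUA; apply: sidon_add => //=.
- by move=> h0; apply: (hB 1%N 0 0 0) => //=; rewrite sub0r -[RHS]add0r -h0 addrK.
- move=> q [Pq|->] /= E; last by lra.
  by apply: (iB 2%N 0 q 0) => //=; [exact: sub|lra].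
- move=> q [Pq|->] /= E.
    by apply: (hB 1%N q 0 0) => //=; [exact: sub|rewrite -E addrK].
  by apply: v0; apply: (addrI h); rewrite E addr0.
- move=> q r s [Pq|->] [Pr|->] [Ps|->] [/= E E'].
  + by apply: (iB 2%N q r s) => //=; [exact: sub..|lra].
  + apply: nP; exists q, r; split => //; apply: eq_pair => /=; first by lra.
    by apply: (addIr h); rewrite -E' addrC (addrC h) addrA.
  + apply: nP; exists q, s; split => //; apply: eq_pair => /=; first by lra.
    by apply: (addrI h); rewrite -E' -addrA (addrC v).
  + by apply: (iB 4%N q 0 0) => //=; [exact: sub|lra].
  + by apply: (iB 3%N 0 r s) => //=; [exact: sub..|lra].
  + by apply: (iB 2%N 0 r 0) => //=; [exact: sub..|lra].
  + by apply: (iB 2%N 0 s 0) => //=; [exact: sub..|lra].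
  + by lra.
- move=> r s [Pr|->] [Ps|->] [/= E E'].
  + by apply: (iB 5%N 0 r s) => //=; [exact: sub..|lra].
  + by apply: (iB 6%N r 0 0) => //=; [exact: sub..|lra].
  + by apply: (iB 6%N s 0 0) => //=; [exact: sub..|lra].
  + by lra.
Qed.

End Sidon.

(** * From Sidon sets to terraces *)

Lemma enumerate K T (t0 : T) : [set: T] #<= [set: K] ->
  exists e : K -> T, forall t, exists k, e k = t.
Proof.
move=> TK; have [k0 _] := card_le_neq0 (ex_intro _ t0 I) TK.
have [f [_ finj]] := card_le_fun k0 TK.
have /choice[e eP] : forall k, exists t, forall t', f t' = k -> t' = t.
  move=> k; case: (pselect (exists t, f t = k)) => [[t <-]|n].
    by exists t => t' /finj; apply.
  by exists t0 => t' ft; case: n; exists t'.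
by exists e => t; exists (f t); rewrite -(eP _ t).
Qed.

Section AdditiveTerrace.
Local Open Scope ring_scope.
Variables (F : realFieldType) (V : zmodType) (I : set F).
Hypothesis Vinf : infinite_set [set: V].
Hypothesis Vsq : [set: V] #<= [set v + v | v in [set: V]].
Hypothesis FV : [set: F] #<= [set: V].
Hypothesis VI : [set: V] #<= I.
Hypothesis Idich : forall d, 0 < d ->
  [set: V] #<= shift_dom I d \/ shift_dom I d = set0.
Local Notation X := (F * V)%type.

(** The three families of requirements: a value at each index, each nonzero value attained, each
    difference attained. Every natural number is a valid kind, so the tasks form a plain product. *)
Definition met (task : nat * X) (P : set X) : Prop :=
  let: (kind, (i, v)) := task in
  match kind with
  | 0 => I i -> exists w, P (i, w)
  | 1 => v <> 0 -> exists j, P (j, v)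
  | _ => 0 < i -> shift_dom I i !=set0 -> v <> 0 ->
      exists x y, [/\ P x, P y & y = x + (i, v)]
  end.

Lemma sidon_meet task P : small V P -> sidon I P ->
  exists x y, sidon I (P `|` [set x; y]) /\ met task (P `|` [set x; y]).
Proof.
move=> sP Pok; have [i0 Ii0] := card_le_neq0 (infinite_setN0 Vinf) VI.
(* A stage adds points even when its requirement is vacuous; the index [i0] is then treated. A
   single point counts as a pair of equal points. *)
have skip : (forall P', met task P') ->
    exists x y, sidon I (P `|` [set x; y]) /\ met task (P `|` [set x; y]).
  move=> tmet; have [v vok] := sidon_add_index Vinf Vsq sP Pok Ii0.
  by exists (i0, v), (i0, v); rewrite setUid.
case: task skip => [[|[|kind]] [i v]] skip.
- case: (pselect (I i)) => [Ii|nIi]; last by apply: skip => P' /nIi.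
  have [w wok] := sidon_add_index Vinf Vsq sP Pok Ii.
  by exists (i, w), (i, w); rewrite setUid; split => // _; exists w; right.
- case: (pselect (v = 0)) => [v0|nv0]; first by apply: skip => P' /(_ v0).
  have [j jok] := sidon_add_value Vinf VI sP Pok nv0.
  by exists (j, v), (j, v); rewrite setUid; split => // _; exists j; right.
- case: (pselect [/\ 0 < i, shift_dom I i !=set0 & v <> 0]) =>
    [[i0' Ii nv0]|n]; last first.
    by apply: skip => P' /= ? ? ?; case: n.
  have [VIi|Ii0'] := Idich i0'; last by move: Ii; rewrite Ii0' => -[].
  have [x [y [ok dxy]]] := sidon_add_difference Vinf i0' VIi sP Pok nv0.
  exists x, y; split => //.
Qed.

Lemma met_mono task (P Q : set X) : P `<=` Q -> met task P -> met task Q.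
Proof.
case: task => [[|[|kind]] [i v]] PQ /= Pmet.
- by move=> /Pmet[w /PQ]; exists w.
- by move=> /Pmet[j /PQ]; exists j.
- move=> i0 Ii v0; have [x [y [/PQ Qx /PQ Qy yE]]] := Pmet i0 Ii v0.
  by exists x, y.
Qed.

Theorem additive_terrace : exists a : F -> V,
  set_bij I [set~ 0] a /\
  forall d, 0 < d -> shift_dom I d !=set0 ->
    set_bij (shift_dom I d) [set~ 0] (fun i => - a i + a (i + d)).
Proof.
have [v0 _] := infinite_setN0 Vinf.
(* The product of [nat], [F] and [V] has at most |V| elements, so [V] can index the stages. *)
have [task taskP] : exists e : V -> nat * X, forall t, exists k, e k = t.
  apply: (enumerate (0%N, 0)).
  have VV : [set: V * V] #<= [set: V].
    by apply: card_le_trans (infinite_card_sq Vinf); apply: subset_card_le.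
  have XV : [set: X] #<= [set: V].
    apply: card_le_trans VV.
    have := card_leX FV (card_lexx [set: V]).
    by rewrite !setXTT.
  apply: card_le_trans VV.
  have /infiniteP NV := Vinf.
  by have := card_leX NV XV; rewrite !setXTT.
have [P [Pok Pmet]] := small_recursion Vinf (0 : X) (ok := sidon_ok I)
  (fun t => @met_mono (task t)) (fun t P sP Pok => sidon_meet (task t) sP Pok).
have {task taskP}Pmet k x : met (k, x) P by have [t <-] := taskP (k, x).
have PI x : P x -> I x.1 by move=> Px; have [] := Pok x x x x Px Px Px Px.
have P0 x : P x -> x.2 <> 0 by move=> Px; have [] := Pok x x x x Px Px Px Px.
have Pfst x y : P x -> P y -> x.1 = y.1 -> x = y.
  by move=> Px Py; have [_ _ + _ _] := Pok x y x y Px Py Px Py; apply.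
have Psnd x y : P x -> P y -> x.2 = y.2 -> x = y.
  by move=> Px Py; have [_ _ _ + _] := Pok x y x y Px Py Px Py; apply.
have Psid p q r s : P p -> P q -> P r -> P s -> p + q = r + s -> p = r \/ p = s.
  by move=> Pp Pq Pr Ps; have [] := Pok p q r s Pp Pq Pr Ps.
have /choice[a aP] : forall i, exists v, I i -> P (i, v).
  move=> i; case: (pselect (I i)) => [Ii|nIi]; last by exists 0.
  by have [v Pv] := Pmet 0%N (i, 0) Ii; exists v.
have aE x : P x -> a x.1 = x.2.
  move=> Px; have /(Pfst _ _ (aP _ (PI _ Px)) Px) : x.1 = x.1 by [].
  by move=> <-.
exists a; split=> [|d d0 Id]; split.
- by move=> i Ii /= ai; apply: (P0 _ (aP _ Ii)).
- move=> i j /set_mem Ii /set_mem Ij aij.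
  by have [] := Psnd _ _ (aP _ Ii) (aP _ Ij) aij.
- move=> v /= nv0; have [i Pi] := Pmet 1%N (0, v) nv0.
  by exists i; [exact: PI Pi|exact: aE Pi].
- move=> i [Ii Iid] /= /eqP; rewrite addrC subr_eq0 => /eqP aa.
  have [] := Psnd _ _ (aP _ Iid) (aP _ Ii) aa.
  by move=> /eqP; rewrite -subr_eq0 addrAC subrr add0r gt_eqF.
- move=> i j /set_mem[Ii Iid] /set_mem[Ij Ijd] /= aa.
  have E : (i + d, a (i + d)) + (j, a j) = (i, a i) + (j + d, a (j + d)).
    rewrite /GRing.add /= /add_pair /=; congr pair; first by rewrite addrAC addrA.
    by apply: (addrI (- a i)); rewrite !addrA addNr add0r aa addrAC addNr add0r.
  have [[ii _]|[]] := Psid _ _ _ _ (aP _ Iid) (aP _ Ij) (aP _ Ii) (aP _ Ijd) E.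
    by move: ii => /eqP; rewrite -subr_eq0 addrAC subrr add0r gt_eqF.
  by move=> /addIr.
- move=> v /= nv0; have [x [y [Px Py yE]]] := Pmet 2%N (d, v) d0 Id nv0.
  exists x.1; first by split; [exact: PI|have := PI _ Py; rewrite yE].
  have := aE _ Py; rewrite {1}yE /= => ->.
  by rewrite aE // yE /= addKr.
Qed.

End AdditiveTerrace.

(** * Ordered fields of prescribed cardinality *)

Section FieldOfCardinality.
Local Open Scope ring_scope.
Variable K : choiceType.

(** The sets containing, for some [s], all sequences that include the entries of [s] form a proper
    filter, concatenation giving intersections; an ultrafilter above it is fine. *)
Lemma exists_fine_ultrafilter : exists U : set_system (seq K),
  UltraFilter U /\ forall x, U [set s : seq K | x \in s].
Proof.
pose B : set_system (seq K) := [set A : set (seq K) |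
  exists s : seq K, forall t : seq K, {subset s <= t} -> A t].
have BF : ProperFilter B.
  apply: Build_ProperFilter_ex => [A [s sA]|]; first by exists s; exact: sA.
  split=> [|A A' [s sA] [s' sA']|A A' AA' [s sA]].
  - by exists [::].
  - exists (s ++ s') => t st; split.
      by apply: sA => x xs; apply: st; rewrite mem_cat xs.
    by apply: sA' => x xs; apply: st; rewrite mem_cat xs orbT.
  - by exists s => t /sA /AA'.
have [U [UU BU]] := ultraFilterLemma BF; exists U; split => // x.
by apply: BU; exists [:: x] => t; apply; rewrite mem_head.
Qed.

Definition fine_ultrafilter : set_system (seq K) :=
  sval (cid exists_fine_ultrafilter).

Local Notation U := fine_ultrafilter.

Let U_ultra : UltraFilter U.
Proof. by have [] := svalP (cid exists_fine_ultrafilter). Qed.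

Let U_proper : ProperFilter U. Proof. by case: U_ultra. Qed.
Let U_filter : Filter U. Proof. by case: U_proper. Qed.
#[local] Existing Instances U_ultra U_proper U_filter.

Lemma fine_ultrafilter_mem x : U [set s : seq K | x \in s].
Proof. exact: (svalP (cid exists_fine_ultrafilter)).2. Qed.

(** For infinite [K] there are only |K| terms, which bounds the field from above; the full
    ultrapower may be larger. *)
Inductive fterm :=
  | Var of K | Zero | One | Add of fterm & fterm | Opp of fterm
  | Mul of fterm & fterm | Inv of fterm.

HB.instance Definition _ := gen_eqMixin fterm.
HB.instance Definition _ := gen_choiceMixin fterm.

Fixpoint feval (s : seq K) (t : fterm) : rat :=
  match t with
  | Var x => (index x s)%:R
  | Zero => 0
  | One => 1
  | Add t u => feval s t + feval s u
  | Opp t => - feval s t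
  | Mul t u => feval s t * feval s u
  | Inv t => (feval s t)^-1
  end.

Definition fterm_eq (t u : fterm) : bool := `[< U [set s | feval s t = feval s u] >].

Lemma fterm_eq_refl : reflexive fterm_eq.
Proof. by move=> t; apply/asboolP; apply: filterE. Qed.

Lemma fterm_eq_sym : symmetric fterm_eq.
Proof. by move=> t u; apply/asboolP/asboolP; apply: filterS => s /= ->. Qed.

Lemma fterm_eq_trans : transitive fterm_eq.
Proof.
move=> u t v /asboolP tu /asboolP uv; apply/asboolP.
by apply: filterS2 tu uv => s /= -> ->.
Qed.

Canonical fterm_equiv := EquivRel fterm_eq fterm_eq_refl fterm_eq_sym fterm_eq_trans.

Local Open Scope quotient_scope.

(* The subfield, generated by the classes of the maps [s |-> index x s], of the
   ultrapower of [rat] along [fine_ultrafilter]: it is presented by terms. *)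
Definition hyperrat := {eq_quot fterm_equiv}.

HB.instance Definition _ := Choice.on hyperrat.

Implicit Types (a b c : hyperrat) (s : seq K).

Definition hval a s : rat := feval s (repr a).
Definition hmk (t : fterm) : hyperrat := \pi_({eq_quot fterm_equiv}) t.

Lemma hvalE t : U [set s | hval (hmk t) s = feval s t].
Proof.
have : \pi_({eq_quot fterm_equiv}) (repr (hmk t)) = hmk t by rewrite reprK.
by move=> /eqmodP/asboolP.
Qed.

Lemma hyperrat_eqP a b : U [set s | hval a s = hval b s] <-> a = b.
Proof.
split=> [ab|->]; last exact: filterE.
rewrite -[a]reprK -[b]reprK; apply/eqmodP; exact/asboolP.
Qed.

Definition hzero := hmk Zero.
Definition hone := hmk One.
Definition hadd a b := hmk (Add (repr a) (repr b)).
Definition hopp a := hmk (Opp (repr a)).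
Definition hmul a b := hmk (Mul (repr a) (repr b)).
Definition hinv a := hmk (Inv (repr a)).

Lemma hval0 : U [set s | hval hzero s = 0]. Proof. exact: hvalE. Qed.
Lemma hval1 : U [set s | hval hone s = 1]. Proof. exact: hvalE. Qed.
Lemma hvalD a b : U [set s | hval (hadd a b) s = hval a s + hval b s].
Proof. exact: hvalE. Qed.
Lemma hvalN a : U [set s | hval (hopp a) s = - hval a s]. Proof. exact: hvalE. Qed.
Lemma hvalM a b : U [set s | hval (hmul a b) s = hval a s * hval b s].
Proof. exact: hvalE. Qed.
Lemma hvalV a : U [set s | hval (hinv a) s = (hval a s)^-1]. Proof. exact: hvalE. Qed.

Fact haddA : associative hadd.
Proof.
move=> a b c; apply/hyperrat_eqP.
apply: filterS3 (hvalD a (hadd b c)) (hvalD b c) _; last first.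
  by apply: filterI (hvalD (hadd a b) c) (hvalD a b).
by move=> s /= -> -> [-> ->]; rewrite addrA.
Qed.
Fact haddC : commutative hadd.
Proof.
move=> a b; apply/hyperrat_eqP.
by apply: filterS2 (hvalD a b) (hvalD b a) => s /= -> ->; rewrite addrC.
Qed.
Fact hadd0 : left_id hzero hadd.
Proof.
move=> a; apply/hyperrat_eqP.
by apply: filterS2 (hvalD hzero a) hval0 => s /= -> ->; rewrite add0r.
Qed.
Fact haddN : left_inverse hzero hopp hadd.
Proof.
move=> a; apply/hyperrat_eqP.
apply: filterS3 (hvalD (hopp a) a) hval0 (hvalN a) => s /= -> -> ->.
by rewrite addNr.
Qed.

HB.instance Definition _ := GRing.isZmodule.Build hyperrat haddA haddC hadd0 haddN.

Fact hmulA : associative hmul.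
Proof.
move=> a b c; apply/hyperrat_eqP.
apply: filterS3 (hvalM a (hmul b c)) (hvalM b c) _; last first.
  by apply: filterI (hvalM (hmul a b) c) (hvalM a b).
by move=> s /= -> -> [-> ->]; rewrite mulrA.
Qed.
Fact hmulC : commutative hmul.
Proof.
move=> a b; apply/hyperrat_eqP.
by apply: filterS2 (hvalM a b) (hvalM b a) => s /= -> ->; rewrite mulrC.
Qed.
Fact hmul1 : left_id hone hmul.
Proof.
move=> a; apply/hyperrat_eqP.
by apply: filterS2 (hvalM hone a) hval1 => s /= -> ->; rewrite mul1r.
Qed.
Fact hmulDl : left_distributive hmul hadd.
Proof.
move=> a b c; apply/hyperrat_eqP.
apply: filterS3 (filterI (hvalM (hadd a b) c) (hvalD a b))
  (hvalD (hmul a c) (hmul b c)) (filterI (hvalM a c) (hvalM b c)).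
by move=> s /= [-> ->] -> [-> ->]; rewrite mulrDl.
Qed.
Fact hone_neq0 : hone != hzero.
Proof.
apply/eqP => /hyperrat_eqP h10.
have : U set0.
  apply: filterS3 h10 hval0 hval1 => s /= -> -> /eqP.
  by rewrite eq_sym oner_eq0.
exact: filter_not_empty.
Qed.

HB.instance Definition _ :=
  GRing.Zmodule_isComNzRing.Build hyperrat hmulA hmulC hmul1 hmulDl hone_neq0.

Fact hmulV a : a != 0 -> hmul (hinv a) a = 1.
Proof.
move=> a0; apply/hyperrat_eqP.
(* The ultrafilter decides whether [a] vanishes almost everywhere; since a <> 0, it is nonzero
   almost everywhere and is inverted pointwise there. *)
have an0 : U [set s | hval a s != 0].
  have [a0'|] := in_ultra_setVsetC [set s | hval a s = 0] U_ultra.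
    have a00 : a = 0.
      by apply/hyperrat_eqP; apply: filterS2 a0' hval0 => s /= -> ->.
    by rewrite a00 eqxx in a0.
  by apply: filterS => s /= /eqP.
apply: filterS3 (filterI (hvalM (hinv a) a) (hvalV a)) hval1 an0.
by move=> s /= [-> ->] -> ?; rewrite mulVf.
Qed.
Fact hinv0 : hinv 0 = 0.
Proof.
apply/hyperrat_eqP; apply: filterS2 (hvalV 0) hval0 => s /= -> ->.
by rewrite invr0.
Qed.

HB.instance Definition _ := GRing.ComNzRing_isField.Build hyperrat hmulV hinv0.

Definition hle a b : bool := `[< U [set s | hval a s <= hval b s] >].
Definition hnorm a := if hle 0 a then a else - a.

Let hvalr0 : U [set s | hval 0 s = 0] := hval0.
Let hvalrD a b : U [set s | hval (a + b) s = hval a s + hval b s] := hvalD a b.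
Let hvalrN a : U [set s | hval (- a) s = - hval a s] := hvalN a.
Let hvalrM a b : U [set s | hval (a * b) s = hval a s * hval b s] := hvalM a b.

Lemma hge0P a : hle 0 a <-> U [set s | 0 <= hval a s].
Proof.
split=> [/asboolP|] h; last apply/asboolP; by apply: filterS2 h hvalr0 => s /= /[swap] ->.
Qed.
Lemma hle0P a : hle a 0 <-> U [set s | hval a s <= 0].
Proof.
split=> [/asboolP|] h; last apply/asboolP; by apply: filterS2 h hvalr0 => s /= /[swap] ->.
Qed.

Fact hle0_add a b : hle 0 a -> hle 0 b -> hle 0 (a + b).
Proof.
move=> /hge0P a0 /hge0P b0; apply/hge0P.
by apply: filterS3 a0 b0 (hvalrD a b) => s /= ? ? ->; exact: addr_ge0.
Qed.
Fact hle0_mul a b : hle 0 a -> hle 0 b -> hle 0 (a * b).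
Proof.
move=> /hge0P a0 /hge0P b0; apply/hge0P.
by apply: filterS3 a0 b0 (hvalrM a b) => s /= ? ? ->; exact: mulr_ge0.
Qed.
Fact hle0_anti a : hle 0 a -> hle a 0 -> a = 0.
Proof.
move=> /hge0P a0 /hle0P a0'; apply/hyperrat_eqP.
by apply: filterS3 a0 a0' hvalr0 => s /= ? ? ->; apply/le_anti/andP.
Qed.
Fact hsub_ge0 a b : hle 0 (b - a) = hle a b.
Proof.
apply/idP/asboolP => [/hge0P|] h; last apply/hge0P.
  apply: filterS3 h (hvalrD b (- a)) (hvalrN a) => s /= h hD hN.
  by rewrite hD hN subr_ge0 in h.
apply: filterS3 h (hvalrD b (- a)) (hvalrN a) => s /= + -> ->.
by rewrite subr_ge0.
Qed.
Fact hle0_total a : hle 0 a || hle a 0.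
Proof.
have [/hge0P->//|] := in_ultra_setVsetC [set s | 0 <= hval a s] U_ultra.
move=> h; apply/orP; right; apply/hle0P; apply: filterS h => s /= /negP.
by rewrite -ltNge => /ltW.
Qed.
Fact hnormN a : hnorm (- a) = hnorm a.
Proof.
have hN b : hle 0 (- b) = hle b 0 by rewrite -sub0r hsub_ge0.
rewrite /hnorm hN opprK; case: ifPn => [a0|/negPf a0]; case: ifPn => [a0'|a0'] //.
  by rewrite (hle0_anti a0' a0) oppr0.
by have := hle0_total a; rewrite a0 (negPf a0').
Qed.
Fact hge0_norm a : hle 0 a -> hnorm a = a.
Proof. by rewrite /hnorm => ->. Qed.

HB.instance Definition _ := Num.IntegralDomain_isLeReal.Build hyperrat
  hle0_add hle0_mul hle0_anti hsub_ge0 hle0_total hnormN hge0_norm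
  (fun _ _ => erefl).

Definition hyperrat_field : realFieldType := hyperrat.

(** A term is coded by a tag for its constructor paired with the codes of its arguments, using a
    copy of [nat] in [K] and an injective pairing on [K]. *)
Lemma card_fterm : infinite_set [set: K] -> [set: fterm] #<= [set: K].
Proof.
move=> Kinf; have [x0 _] := infinite_setN0 Kinf.
have /infiniteP/(card_le_fun x0)[tag [_ tag_inj]] := Kinf.
have KK : [set: K * K] #<= [set: K].
  by apply: card_le_trans (infinite_card_sq Kinf); apply: subset_card_le.
have [pr [_ pr_inj]] := card_le_fun x0 KK.
have {}pr_inj x y x' y' : pr (x, y) = pr (x', y') -> x = x' /\ y = y'.
  by move=> /(pr_inj _ _ I I)[-> ->].
have {}tag_inj m n : tag m = tag n -> m = n by exact: tag_inj.
pose code := fix code t := match t with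
  | Var x => pr (tag 0%N, x)
  | Zero => pr (tag 1%N, x0)
  | One => pr (tag 2%N, x0)
  | Add t u => pr (tag 3%N, pr (code t, code u))
  | Opp t => pr (tag 4%N, code t)
  | Mul t u => pr (tag 5%N, pr (code t, code u))
  | Inv t => pr (tag 6%N, code t)
  end.
apply: (@card_le_inj _ _ _ _ code) => // t u _ _.
elim: t u => [x|||t IHt t' IHt'|t IHt|t IHt t' IHt'|t IHt] [y|||u u'|u|u u'|u] //=
  /pr_inj[/tag_inj // _] //.
- by move=> ->.
- by move=> /pr_inj[/IHt -> /IHt' ->].
- by move=> /IHt ->.
- by move=> /pr_inj[/IHt -> /IHt' ->].
- by move=> /IHt ->.
Qed.

(** Representatives embed the field into the terms. Conversely, almost every [s] contains both [x]
    and [y], and equal positions in such an [s] force x = y. *)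
Lemma card_hyperrat : infinite_set [set: K] -> [set: hyperrat] #= [set: K].
Proof.
move=> Kinf; rewrite card_eq_le; apply/andP; split.
  apply: card_le_trans (card_fterm Kinf).
  apply: (@card_le_inj _ _ _ _ (fun a : hyperrat => repr a)) => // a b _ _ ab.
  by rewrite -[a]reprK -[b]reprK ab.
apply: (@card_le_inj _ _ _ _ (fun x => hmk (Var x))) => // x y _ _ xy.
have : U [set s | x = y].
  have Uxy : U [set s | hval (hmk (Var x)) s = hval (hmk (Var y)) s].
    by rewrite xy; exact: filterE.
  apply: filterS3 (filterI (hvalE (Var x)) (hvalE (Var y))) Uxy
    (filterI (fine_ultrafilter_mem x) (fine_ultrafilter_mem y)).
  move=> s /= [-> ->] /eqP; rewrite eqr_nat => /eqP ixy [xs ys].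
  by rewrite -(nth_index x xs) ixy nth_index.
by move=> /filter_ex[].
Qed.

End FieldOfCardinality.

(** * Passage to multiplicative groups *)

Section AdditiveCopy.
Variables (G : groupType) (abelG : forall x y : G, (x * y)%g = (y * x)%g).

(* The vacuous let keeps abelG among the parameters of the type, so that the
   zmodType instance below is canonical. *)
Definition additive_copy : Type := let _ := abelG in G.

HB.instance Definition _ := Choice.copy additive_copy G.
HB.instance Definition _ := GRing.isZmodule.Build additive_copy
  (@mulgA G) abelG (@mul1g G) (@mulVg G).

End AdditiveCopy.

Theorem theorem5p2 (G : groupType)
    (abelG : forall x y : G, (x * y)%g = (y * x)%g)
    (infG : infinite_set [set: G])
    (sqG : squareful G) :
  has_directed_terrace G /\
  (forall (F : realFieldType) (I : set F),
     index_set I -> I #= [set: G] ->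
     exists a : F -> G, directed_terrace I a).
Proof.
have terrace (F : realFieldType) (I : set F) : index_set I -> I #= [set: G] ->
    exists a : F -> G, directed_terrace I a.
  move=> [IF Idich] IG.
  have /andP[IleF FleI] : (I #<= [set: F]) && ([set: F] #<= I) by rewrite -card_eq_le.
  have /andP[IleG GleI] : (I #<= [set: G]) && ([set: G] #<= I) by rewrite -card_eq_le.
  apply: (@additive_terrace F (additive_copy abelG) I) => //.
  - by move: sqG; rewrite /squareful card_eq_le => /andP[].
  - exact: card_le_trans FleI IleG.
  - move=> d /Idich[|->]; last by right.
    rewrite card_eq_le => /andP[_ FleId]; left.
    exact: card_le_trans GleI (card_le_trans IleF FleId).
split=> //.
have FG : [set: hyperrat_field G] #= [set: G] := card_hyperrat infG.
(* The whole field is an index set, each of its shift domains being everything; the first claim is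
   thus an instance of the second. *)
have index_setT : index_set [set: hyperrat_field G].
  split=> // d _; left; rewrite (_ : shift_dom _ _ = setT) //.
  by rewrite -subTset => i _; split.
exists (hyperrat_field G), setT; split => //.
exact: terrace.
Qed.
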